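(* Let $M=(m_{ij})\in\mathbb{Z}^{d\times d}$ satisfy $m_{ii}=0$ for all $i$, $m_{ij}+m_{jk}\ge m_{ik}$ for all $i,j,k$, $M\ge 0$ entrywise, and $m_{ij}+m_{ji}>0$ for all $i\ne j$. Then the polytrope $$Q_M=\{u\in\mathbb{R}^d/\mathbb{R}\mathbf{1}:\ u_i-u_j\le m_{ij}\ \text{for }1\le i,j\le d\}$$ is $(d-1)$-dimensional and is both a min-plus simplex and a max-plus simplex. Its min-plus vertices are (the images in $\mathbb{R}^d/\mathbb{R}\mathbf{1}$ of) the $d$ columns of $M$, and for an integer point $u\in Q_M$ the $\Lambda_M$-lattice $L_u$ is projective if and only if $u$ is one of these min-plus vertices. Its max-plus vertices are (the images of) the $d$ columns of $-M^t$, and for an integer point $v\in Q_M$ the $\Lambda_M$-lattice $L_v$ is injective if and only if $v$ is one of these max-plus vertices.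
   Context: $K$ is a field with a surjective discrete valuation $\mathrm{val}:K\to\mathbb{Z}\cup\{\infty\}$, $p\in K$ with $\mathrm{val}(p)=1$, $\mathcal{O}_K$ its valuation ring. $\Lambda_M=\{X\in K^{d\times d}:\mathrm{val}(x_{ij})\ge m_{ij}\ \forall i,j\}$, which under the hypotheses is an order (a lattice in $K^{d\times d}$ that is a subring). For $u\in\mathbb{Z}^d$, $L_u=\mathrm{diag}(p^{u_1},\dots,p^{u_d})\,\mathcal{O}_K^d$, a $\Lambda_M$-module when $u\in Q_M$. $\mathbf{1}=(1,\dots,1)$. The min-plus convex hull of points $v_1,\dots,v_d\in\mathbb{R}^d/\mathbb{R}\mathbf{1}$ is the set of all coordinatewise minima $\min_j(\lambda_j\mathbf{1}+v_j)$, $\lambda\in\mathbb{R}^d$; the max-plus convex hull is defined with maximum instead. A min-plus (resp.\ max-plus) simplex is a set equal to the min-plus (resp.\ max-plus) convex hull of $d$ points, which are then its min-plus (resp.\ max-plus) vertices. Projective/injective refer to $\Lambda_M$-lattices (lattices in $K^d$ with a $\Lambda_M$-module structure), injectivity being understood in the category of $\Lambda_M$-lattices (equivalently, $L$ is injective iff its $\mathcal{O}_K$-dual $\mathrm{Hom}_{\mathcal{O}_K}(L,\mathcal{O}_K)$ is a projective right $\Lambda_M$-module). *)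

(* Defs.v *)
From HB Require Import structures.
From mathcomp Require Import all_boot all_order all_algebra.
From mathcomp Require Import all_classical all_reals.

Set Implicit Arguments.
Unset Strict Implicit.
Unset Printing Implicit Defensive.

Import Order.TTheory GRing.Theory Num.Theory.

Local Open Scope classical_set_scope.
Local Open Scope ring_scope.
Local Open Scope quotient_scope.

Section TropicalTorus.
Variables (R : realType) (d : nat).

Definition ones_line : {pred 'cV[R]_d} :=
  fun x => `[< exists c : R, x = const_mx c >].

Fact ones_line_zmod_closed : zmod_closed ones_line.
Proof.
split; first by apply/asboolP; exists 0; apply/matrixP => i j; rewrite !mxE.
move=> _ _ /asboolP[a ->] /asboolP[b ->]; apply/asboolP; exists (a - b).
by apply/matrixP => i j; rewrite !mxE.
Qed.

HB.instance Definition _ :=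
  GRing.isZmodClosed.Build 'cV[R]_d ones_line ones_line_zmod_closed.

Definition torus := Quotient.quot ones_line.

HB.instance Definition _ := GRing.Zmodule.on torus.
HB.instance Definition _ := EqQuotient.on torus.

Definition torus_pi (x : 'cV[R]_d) : torus := \pi_torus x.

Definition torus_scale (a : R) (x : torus) : torus := torus_pi (a *: repr x).

Fact torus_piB x y : torus_pi (x - y) = torus_pi x - torus_pi y.
Proof. by rewrite /torus_pi !piE. Qed.

Fact torus_piD x y : torus_pi (x + y) = torus_pi x + torus_pi y.
Proof. by rewrite /torus_pi !piE. Qed.

Fact torus_piP x y :
  torus_pi x = torus_pi y <-> exists c : R, x - y = const_mx c.
Proof.
split; first by move=> /eqP; rewrite -Quotient.idealrBE => /asboolP.
by move=> xy; apply/eqP; rewrite -Quotient.idealrBE; apply/asboolP.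
Qed.

Fact torus_piZ a x : torus_scale a (torus_pi x) = torus_pi (a *: x).
Proof.
have [c xc] : exists c : R, repr (torus_pi x) - x = const_mx c.
  by apply/torus_piP; rewrite /torus_pi reprK.
apply/torus_piP; exists (a * c); rewrite -scalerBr xc.
by apply/matrixP => i j; rewrite !mxE.
Qed.

Fact torus_scaleA a b x :
  torus_scale a (torus_scale b x) = torus_scale (a * b) x.
Proof. by rewrite {2}/torus_scale torus_piZ scalerA. Qed.

Fact torus_scale1 : left_id 1 torus_scale.
Proof. by move=> x; rewrite /torus_scale scale1r /torus_pi reprK. Qed.

Fact torus_scaleDr : right_distributive torus_scale +%R.
Proof.
move=> a x y; rewrite -[x]reprK -[y]reprK -!/(torus_pi _) -torus_piD.
by rewrite !torus_piZ scalerDr torus_piD.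
Qed.

Fact torus_scaleDl x : {morph torus_scale^~ x : a b / a + b}.
Proof. by move=> a b; rewrite /torus_scale scalerDl torus_piD. Qed.

HB.instance Definition _ := GRing.Zmodule_isLmodule.Build R torus
  torus_scaleA torus_scale1 torus_scaleDr torus_scaleDl.

End TropicalTorus.

Section AffineDimension.
Variables (R : realType) (V : lmodType R).

Definition affinely_independent (n : nat) (x : 'I_n -> V) : Prop :=
  forall c : 'I_n -> R, \sum_i c i = 0 -> \sum_i c i *: x i = 0 ->
    forall i, c i = 0.

(* The dimension of the affine hull: [S] contains [n + 1] affinely independent
   points, but not [n + 2]. *)
Definition has_dimension (S : set V) (n : nat) : Prop :=
  (exists2 x : 'I_n.+1 -> V, affinely_independent x & forall i, S (x i)) /\
  ~ (exists2 x : 'I_n.+2 -> V, affinely_independent x & forall i, S (x i)).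

End AffineDimension.

Section TropicalConvexity.
Variables (R : realType) (d : nat).

Definition is_min (n : nat) (w : 'I_n -> R) (a : R) : Prop :=
  (exists j, a = w j) /\ (forall j, a <= w j).

Definition is_max (n : nat) (w : 'I_n -> R) (a : R) : Prop :=
  (exists j, a = w j) /\ (forall j, w j <= a).

(* The choice of representatives of the points [v j] is immaterial, since the
   parameters [lam j] range over all of [R]. *)
Definition minplus_hull (n : nat) (v : 'I_n -> torus R d) : set (torus R d) :=
  [set torus_pi x | x in [set x : 'cV[R]_d | exists lam : 'I_n -> R,
     forall i, is_min (fun j => lam j + repr (v j) i 0) (x i 0)]].

Definition maxplus_hull (n : nat) (v : 'I_n -> torus R d) : set (torus R d) :=
  [set torus_pi x | x in [set x : 'cV[R]_d | exists lam : 'I_n -> R,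
     forall i, is_max (fun j => lam j + repr (v j) i 0) (x i 0)]].

Definition minplus_vertices (S : set (torus R d)) (v : 'I_d -> torus R d) :=
  S = minplus_hull v.

Definition maxplus_vertices (S : set (torus R d)) (v : 'I_d -> torus R d) :=
  S = maxplus_hull v.

Definition minplus_simplex (S : set (torus R d)) : Prop :=
  exists v, minplus_vertices S v.

Definition maxplus_simplex (S : set (torus R d)) : Prop :=
  exists v, maxplus_vertices S v.

End TropicalConvexity.

Definition polytropal (R : numDomainType) (d : nat) (M : 'M[R]_d)
    (u : 'cV[R]_d) : Prop :=
  forall i j, u i 0 - u j 0 <= M i j.

Definition polytrope (R : realType) (d : nat) (M : 'M[int]_d) :
    set (torus R d) :=
  [set torus_pi u | u in [set u | polytropal (map_mx intr M) u]].
Arguments polytrope R {d} M.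

Definition int_point (R : realType) (d : nat) (u : 'cV[int]_d) : torus R d :=
  torus_pi (map_mx intr u).

Definition exponent_matrix (d : nat) (M : 'M[int]_d) : Prop :=
  (forall i, M i i = 0) /\ (forall i j k, M i k <= M i j + M j k).

Definition projective (A : pzRingType) (P : lmodType A) : Prop :=
  forall (N N' : lmodType A) (g : {linear N -> N'}) (f : {linear P -> N'}),
    (forall y, exists x, g x = y) -> exists h : {linear P -> N}, g \o h =1 f.

Definition short_exact (A : pzRingType) (X Y Z : lmodType A)
    (f : {linear X -> Y}) (g : {linear Y -> Z}) : Prop :=
  [/\ injective f, forall y, g y = 0 <-> exists x, f x = y
    & forall z, exists y, g y = z].

Record valuation (K : fieldType) := Valuation {
  valuation_fun :> K -> \bar int;
  valuation_neqNy : forall x, valuation_fun x <> -oo%E;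
  valuation_eqy : forall x, valuation_fun x = +oo%E <-> x = 0;
  valuationM : forall x y,
    valuation_fun (x * y) = (valuation_fun x + valuation_fun y)%E;
  valuationD : forall x y,
    (Order.min (valuation_fun x) (valuation_fun y)
       <= valuation_fun (x + y)%R)%E;
  valuation_surj : forall n : int, exists x, valuation_fun x = n%:E
}.

Section ValuationTheory.
Variables (K : fieldType) (v : valuation K).

Fact valuation0 : v 0 = +oo%E.
Proof. exact/valuation_eqy. Qed.

Fact valuation_fin x : x != 0 -> exists n : int, v x = n%:E.
Proof.
case E: (v x) => [n| |] x0; first by exists n.
  by move/valuation_eqy: E x0 => ->; rewrite eqxx.
by move/valuation_neqNy: E.
Qed.

Fact valuation1 : v 1 = 0%E.
Proof.
have [n vn] := valuation_fin (oner_neq0 K).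
have := valuationM v 1 1; rewrite mulr1 vn -EFinD => -[] /esym/eqP.
by rewrite -subr_eq0 addrK => /eqP ->.
Qed.

Fact valuationN x : v (- x) = v x.
Proof.
suff v1 : v (-1) = 0%E by rewrite -mulN1r valuationM v1 add0e.
have N10 : (-1 : K) != 0 by rewrite oppr_eq0 oner_neq0.
have [n vn] := valuation_fin N10.
have := valuationM v (-1) (-1); rewrite mulrNN mulr1 valuation1 vn -EFinD.
by move=> [] /esym/eqP; rewrite -mulr2n mulrn_eq0 => /eqP ->.
Qed.

Fact valuation_geD (a : \bar int) x y :
  (a <= v x)%E -> (a <= v y)%E -> (a <= v (x + y)%R)%E.
Proof.
by move=> ax ay; apply: le_trans (valuationD v x y); rewrite le_min ax ay.
Qed.

Fact valuation_geM (a b : \bar int) x y :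
  (a <= v x)%E -> (b <= v y)%E -> (a + b <= v (x * y)%R)%E.
Proof. by move=> ax xy; rewrite valuationM leeD. Qed.

Fact valuation_ge_sum (a : \bar int) (I : finType) (F : I -> K) :
  (forall i, (a <= v (F i))%E) -> (a <= v (\sum_i F i)%R)%E.
Proof.
move=> aF; apply: (@big_ind _ (fun x => (a <= v x)%E)) => //.
  by rewrite valuation0 leey.
exact: valuation_geD.
Qed.

Definition valuation_integer : {pred K} := fun x => (0 <= v x)%E.

Fact valuation_integer_subring : subring_closed valuation_integer.
Proof.
split=> [|x y vx vy|x y vx vy]; rewrite unfold_in ?valuation1 //.
  by apply: valuation_geD => //; rewrite valuationN.
by rewrite -[0%E]adde0; apply: valuation_geM.
Qed.

HB.instance Definition _ :=
  GRing.isSubringClosed.Build K valuation_integer valuation_integer_subring.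

Definition valuation_ring := {x : K | x \in valuation_integer}.

HB.instance Definition _ := SubChoice.on valuation_ring.
HB.instance Definition _ :=
  [SubChoice_isSubComNzRing of valuation_ring by <:].

End ValuationTheory.

Section Order.
Variables (K : fieldType) (v : valuation K) (d : nat) (M : 'M[int]_d).

Definition order_pred (hM : exponent_matrix M) : {pred 'M[K]_d} :=
  fun X => [forall i, forall j, ((M i j)%:E <= v (X i j))%E].

Variable hM : exponent_matrix M.

Fact order_predP (X : 'M[K]_d) :
  reflect (forall i j, ((M i j)%:E <= v (X i j))%E) (X \in order_pred hM).
Proof.
apply: (iffP forallP) => H i; first by move=> j; have /forallP := H i; apply.
exact/forallP.
Qed.

Fact order_subring : subring_closed (order_pred hM).
Proof.
have [M0 Mtri] := hM; split=> [|X Y|X Y].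
- apply/order_predP => i j; rewrite mxE.
  case: eqP => [->|_]; first by rewrite M0 valuation1.
  by rewrite valuation0 leey.
- move=> /order_predP vX /order_predP vY; apply/order_predP => i j.
  by rewrite !mxE; apply: valuation_geD => //; rewrite valuationN.
- move=> /order_predP vX /order_predP vY; apply/order_predP => i k.
  rewrite mxE; apply: valuation_ge_sum => j.
  by apply: le_trans (valuation_geM (vX i j) (vY j k)); rewrite -EFinD lee_fin.
Qed.

Definition order := {X : 'M[K]_d | X \in order_pred hM}.

HB.instance Definition _ := SubChoice.on order.
HB.instance Definition _ := GRing.SubChoice_isSubPzRing.Build
  'M[K]_d (order_pred hM) order order_subring.

Fact scalar_order (a : valuation_ring v) :
  (\val a)%:M \in order_pred hM.
Proof.
have [M0 _] := hM; apply/order_predP => i j; rewrite mxE.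
case: eqP => [->|_]; first by rewrite M0 mulr1n; exact: (valP a).
by rewrite mulr0n valuation0 leey.
Qed.

Definition order_scalar (a : valuation_ring v) : order :=
  exist _ (\val a)%:M (scalar_order a).

(* A module over the order that is a lattice, i.e. that is free of finite rank
   over the valuation ring, which acts through the scalar matrices. *)
Definition is_lattice (L : lmodType order) : Prop :=
  exists (n : nat) (b : 'I_n -> L),
    bijective (fun c : {ffun 'I_n -> valuation_ring v} =>
                 \sum_i order_scalar (c i) *: b i).

(* Injectivity in the category of lattices is relative to the short exact
   sequences of lattices: no nonzero lattice is injective with respect to all
   monomorphisms, since multiplication by a uniformizer is one of them. *)
Definition injective_lattice (L : lmodType order) : Prop :=
  forall (X Y Z : lmodType order) (f : {linear X -> Y}) (g : {linear Y -> Z}),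
    is_lattice X -> is_lattice Y -> is_lattice Z -> short_exact f g ->
    forall h : {linear X -> L}, exists k : {linear Y -> L}, k \o f =1 h.

End Order.

Section DiagonalLattice.
Variables (K : fieldType) (v : valuation K) (d : nat) (M : 'M[int]_d).
Variables (hM : exponent_matrix M) (p : K) (hp : v p = 1%:E).
Variables (u : 'cV[int]_d) (hu : polytropal M u).

Definition diag_lattice_pred : {pred 'cV[K]_d} := fun x =>
  `[< exists y : 'cV[valuation_ring v]_d,
        x = diag_mx (\row_i p ^ u i 0) *m map_mx \val y >].

Fact valuation_exp (n : int) : v (p ^ n) = n%:E.
Proof.
have p0 : p != 0.
  by apply/eqP => p0; move: hp; rewrite p0 valuation0.
have vX (m : nat) : v (p ^+ m) = (m%:Z)%:E.
  elim: m => [|m IH]; first by rewrite expr0 valuation1.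
  by rewrite exprS valuationM IH hp -EFinD intS.
case: n => m; first exact: vX.
rewrite NegzE; change (p ^ (- m.+1%:Z)) with (p ^+ m.+1)^-1.
have pm0 : p ^+ m.+1 != 0 by rewrite expf_neq0.
have [k vk] := valuation_fin v (invr_neq0 pm0).
have := valuationM v (p ^+ m.+1) (p ^+ m.+1)^-1.
rewrite divff // valuation1 vX vk -EFinD => -[] /esym/eqP.
by rewrite addrC addr_eq0 => /eqP ->.
Qed.

Fact diag_lattice_predP (x : 'cV[K]_d) :
  reflect (forall i, ((u i 0)%:E <= v (x i 0)%R)%E) (x \in diag_lattice_pred).
Proof.
have p0 : p != 0.
  by apply/eqP => p0; move: hp; rewrite p0 valuation0.
apply: (iffP (asboolP _)) => [[y ->] i|vx].
  rewrite mul_diag_mx !mxE valuationM valuation_exp -[X in (X <= _)%E]adde0.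
  by apply: leeD => //; exact: (valP (y i 0)).
have y_int i : p ^ (- u i 0) * x i 0 \in valuation_integer v.
  rewrite unfold_in valuationM valuation_exp.
  rewrite -[0%E]/((0 : int)%:E) -(addNr (u i 0)) EFinD.
  exact: leeD.
pose y i : valuation_ring v :=
  exist (fun z => z \in valuation_integer v) _ (y_int i).
exists (\col_i y i); apply/matrixP => i j.
by rewrite ord1 mul_diag_mx !mxE /= mulrA -expfzDr // subrr expr0z mul1r.
Qed.

(* The hypotheses are arguments of the type, because the module structure
   depends on them. *)
Definition diag_lattice_of (_ : exponent_matrix M) (_ : v p = 1%:E)
    (_ : polytropal M u) := {x : 'cV[K]_d | x \in diag_lattice_pred}.

Fact diag_lattice_zmod_closed : zmod_closed diag_lattice_pred.
Proof.
split; first by apply/diag_lattice_predP => i; rewrite mxE valuation0 leey.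
move=> x y /diag_lattice_predP vx /diag_lattice_predP vy.
apply/diag_lattice_predP => i; rewrite !mxE.
by apply: valuation_geD => //; rewrite valuationN.
Qed.

Notation diag_lattice := (diag_lattice_of hM hp hu).

HB.instance Definition _ := SubChoice.on diag_lattice.
HB.instance Definition _ := GRing.SubChoice_isSubZmodule.Build
  'cV[K]_d diag_lattice_pred diag_lattice diag_lattice_zmod_closed.

Fact diag_lattice_act (X : order v hM) (x : diag_lattice) :
  \val X *m \val x \in diag_lattice_pred.
Proof.
have /order_predP vX := valP X; have /diag_lattice_predP vx := valP x.
apply/diag_lattice_predP => i; rewrite mxE; apply: valuation_ge_sum => j.
apply: le_trans (valuation_geM (vX i j) (vx j)).
by rewrite -EFinD lee_fin -lerBlDr; exact: hu.
Qed.

Definition diag_lattice_scale (X : order v hM) (x : diag_lattice) :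
  diag_lattice := exist _ (\val X *m \val x) (diag_lattice_act X x).

Fact diag_lattice_scaleA X Y x :
  diag_lattice_scale X (diag_lattice_scale Y x) = diag_lattice_scale (X * Y) x.
Proof. by apply: val_inj; rewrite /= mulmxA. Qed.

Fact diag_lattice_scale1 : left_id 1 diag_lattice_scale.
Proof. by move=> x; apply: val_inj; rewrite /= mul1mx. Qed.

Fact diag_lattice_scaleDr : right_distributive diag_lattice_scale +%R.
Proof. by move=> X x y; apply: val_inj; rewrite /= mulmxDr. Qed.

Fact diag_lattice_scaleDl x :
  {morph diag_lattice_scale^~ x : X Y / X + Y}.
Proof. by move=> X Y; apply: val_inj; rewrite /= mulmxDl. Qed.

HB.instance Definition _ := GRing.Zmodule_isLmodule.Build (order v hM)
  diag_lattice diag_lattice_scaleA diag_lattice_scale1 diag_lattice_scaleDr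
  diag_lattice_scaleDl.

End DiagonalLattice.

Definition diag_lattice (K : fieldType) (v : valuation K) (d : nat)
    (M : 'M[int]_d) (hM : exponent_matrix M) (p : K) (hp : v p = 1%:E)
    (u : 'cV[int]_d) (hu : polytropal M u) : lmodType (order v hM) :=
  diag_lattice_of hM hp hu.

Fact diag_lattice_is_lattice (K : fieldType) (v : valuation K) (d : nat)
    (M : 'M[int]_d) (hM : exponent_matrix M) (p : K) (hp : v p = 1%:E)
    (u : 'cV[int]_d) (hu : polytropal M u) :
  is_lattice (diag_lattice hM hp hu).
Proof.
have p0 : p != 0 by apply/eqP => p0; move: hp; rewrite p0 valuation0.
have b_in i : p ^ u i 0 *: delta_mx i 0 \in diag_lattice_pred v p u.
  apply/(diag_lattice_predP hp) => j; rewrite !mxE eqxx andbT.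
  case: eqP => [->|_]; first by rewrite mulr1 (valuation_exp hp).
  by rewrite mulr0 valuation0 leey.
pose b i : diag_lattice hM hp hu :=
  exist (fun z => z \in diag_lattice_pred v p u) _ (b_in i).
exists d, b.
have sumE (c : {ffun 'I_d -> valuation_ring v}) i :
    val (\sum_j order_scalar hM (c j) *: b j) i 0 = p ^ u i 0 * \val (c i).
  rewrite raddf_sum /= summxE (bigD1 i) //= big1 => [|j ji];
    rewrite mul_scalar_mx !mxE ?eqxx ?mulr1 ?addr0 1?mulrC //.
  by rewrite eq_sym (negPf ji) mulr0 mul0r.
have c_in (x : diag_lattice hM hp hu) i :
    p ^ (- u i 0) * \val x i 0 \in valuation_integer v.
  have /(diag_lattice_predP hp)/(_ i) vx := valP x.
  rewrite unfold_in valuationM (valuation_exp hp).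
  by rewrite -[0%E]/((0 : int)%:E) -(addNr (u i 0)) EFinD; exact: leeD.
pose g x : {ffun 'I_d -> valuation_ring v} :=
  [ffun i => exist (fun z => z \in valuation_integer v) _ (c_in x i)].
exists g => [c|x].
  apply/ffunP => i; rewrite ffunE; apply: val_inj => /=.
  by rewrite sumE mulrA -expfzDr // addNr expr0z mul1r.
apply: val_inj; apply/matrixP => i j; rewrite ord1 sumE ffunE /=.
by rewrite mulrA -expfzDr // subrr expr0z mul1r.
Qed.

(* Main.v *)
(** The point is that [u = min_j (u_j + M e_j)] for every [u] in the polytrope,
    so the columns of [M] generate it, and each column is extremal, so any [d]
    generators are the columns. The max-plus case follows by [u |-> -u], which
    exchanges [M] and its transpose.

    The order is, as a left module over itself, the direct sum of the lattices of
    the columns of [M], and it surjects onto [L_u] by [X |-> X x0] with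
    [x0 = (p ^ u i)_i]. If [L_u] is projective, this surjection splits, and
    comparing valuations in a splitting shows that [L_u] is, up to scaling, the
    lattice of a column. Dually, [L_u] embeds into a sum of lattices of columns
    of [- M^T] as the matrices with constant rows, with a lattice as cokernel, and
    a retraction of this embedding singles out a column. Conversely,
    homomorphisms out of the lattice of a column of [M] are determined by the image
    of one vector, and homomorphisms into the lattice of a column of [- M^T] by one
    linear form over the valuation ring. *)

Require Import Defs.
From HB Require Import structures.
From mathcomp Require Import all_boot all_order all_algebra perm.
From mathcomp Require Import all_classical all_reals.
From mathcomp Require Import ring lra zify.

Set Implicit Arguments.
Unset Strict Implicit.
Unset Printing Implicit Defensive.

Import Order.TTheory GRing.Theory Num.Theory.

Local Open Scope ring_scope.

(** * Tropical hulls and the vertices of the polytrope *)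

Section Hulls.
Variables (R : realType) (d : nat).
Implicit Types (A : 'M[R]_d) (x : 'cV[R]_d).

Definition polytrope_of A : set (torus R d) :=
  [set torus_pi x | x in [set x | polytropal A x]]%classic.

Lemma torus_pi_repr (y : torus R d) : torus_pi (repr y) = y.
Proof. exact: reprK. Qed.

Lemma torus_piN x : torus_pi (- x) = - torus_pi x.
Proof. by rewrite /torus_pi !piE. Qed.

Lemma torus_pi0 : torus_pi 0 = 0 :> torus R d.
Proof. by rewrite /torus_pi !piE. Qed.

Lemma torus_pi_sum (I : finType) (c : I -> R) (x : I -> 'cV[R]_d) :
  \sum_i c i *: torus_pi (x i) = torus_pi (\sum_i c i *: x i).
Proof.
rewrite (big_morph _ (@torus_piD R d) torus_pi0); apply: eq_bigr => i _.
exact: torus_piZ.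
Qed.

Lemma polytrope_of_pi A x : polytrope_of A (torus_pi x) <-> polytropal A x.
Proof.
split=> [[y Qy /torus_piP [c yxc]]|Qx]; last by exists x.
move=> i j; have xE k : x k 0 = y k 0 - c.
  by move/matrixP/(_ k 0): yxc; rewrite !mxE => <-; rewrite subKr.
by rewrite !xE opprB addrA subrK; exact: Qy.
Qed.

(** Changing representatives adds constants, which the parameters [lam] absorb. *)
Lemma minplus_hull_pi n (a : 'I_n -> 'cV[R]_d) x :
  minplus_hull (fun j => torus_pi (a j)) (torus_pi x) <->
  exists lam : 'I_n -> R, forall i, is_min (fun j => lam j + a j i 0) (x i 0).
Proof.
have /choice [c cE] j : exists c : R,
    forall i, repr (torus_pi (a j)) i 0 = a j i 0 + c.
  have /torus_piP [c cE] := torus_pi_repr (torus_pi (a j)); exists c => i.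
  by move/matrixP/(_ i 0): cE; rewrite !mxE; lra.
split=> [[y [lam ymin] /torus_piP [e eE]]|[lam xmin]].
- have xE i : x i 0 = y i 0 - e.
    by move/matrixP/(_ i 0): eE; rewrite !mxE => <-; rewrite subKr.
  exists (fun j => lam j + c j - e) => i; have [[j yj] yle] := ymin i.
  split; first by exists j; rewrite xE yj cE; ring.
  by move=> l; have := yle l; rewrite xE cE; lra.
- exists x => //; exists (fun j => lam j - c j) => i; have [[j xj] xle] := xmin i.
  split; first by exists j; rewrite xj cE; ring.
  by move=> l; have := xle l; rewrite cE; lra.
Qed.

(** Negating points and parameters turns maxima into minima. *)
Lemma maxplus_hullN n (w : 'I_n -> torus R d) y :
  maxplus_hull w y <-> minplus_hull (fun j => - w j) (- y).
Proof.
rewrite -[y]torus_pi_repr -torus_piN.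
under [fun j => - w j]funext do rewrite -[w _]torus_pi_repr -torus_piN.
rewrite minplus_hull_pi; split=> [[x [lam xmax] /torus_piP [e eE]]|[lam xmin]].
- have xE i : x i 0 = repr y i 0 + e.
    by move/matrixP/(_ i 0): eE; rewrite !mxE; lra.
  exists (fun j => e - lam j) => i; have [[j xj] xle] := xmax i.
  split; first by exists j; move: xj; rewrite xE !mxE; lra.
  by move=> l; have := xle l; rewrite xE !mxE; lra.
- exists (repr y) => //; exists (fun j => - lam j) => i.
  have [[j xj] xle] := xmin i.
  split; first by exists j; move: xj; rewrite !mxE; lra.
  by move=> l; have := xle l; rewrite !mxE; lra.
Qed.

(** The other points are raised by bounds [c j] until they lie above [w k] in every coordinate. *)
Lemma minplus_hull_vertex n (w : 'I_n -> torus R d) k : minplus_hull w (w k).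
Proof.
under [w]funext do rewrite -[w _]torus_pi_repr.
rewrite minplus_hull_pi.
have bound j : exists c : R, forall i, repr (w k) i 0 - repr (w j) i 0 <= c.
  exists (\sum_i `|repr (w k) i 0 - repr (w j) i 0|) => i.
  by rewrite (bigD1 i) //= (le_trans (ler_norm _)) // lerDl sumr_ge0.
have /choice [c cE] := bound; exists (fun j => if j == k then 0 else c j) => i.
split; first by exists k; rewrite eqxx add0r.
by move=> j; case: eqP => [->|_]; [rewrite add0r | rewrite -lerBlDr cE].
Qed.

(** The parameters for [y] are its own coordinates: the defining inequalities make [y] a lower
    bound, attained on the diagonal of [A]. Conversely, the triangle inequality puts minima of
    columns in the polytrope. *)
Lemma polytrope_of_columns A (s : 'S_d) :
  (forall i, A i i = 0) -> (forall i j k, A i k <= A i j + A j k) ->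
  polytrope_of A = minplus_hull (fun j => torus_pi (col (s j) A)).
Proof.
move=> A0 Atri; apply/seteqP; split=> y; rewrite -[y]torus_pi_repr.
- rewrite polytrope_of_pi minplus_hull_pi => Qy.
  exists (fun j => repr y (s j) 0) => i; split.
    by exists ((s^-1)%g i); rewrite permKV mxE A0 addr0.
  by move=> j; rewrite mxE -lerBlDl; exact: Qy.
- rewrite polytrope_of_pi minplus_hull_pi => -[lam ymin] i j.
  have [_ yi] := ymin i; have [[k ->] _] := ymin j.
  by have := yi k; have := Atri i j (s k); rewrite !mxE; lra.
Qed.

(* A column of [A] is extremal in the polytrope: if it is a minimum of points of
   the polytrope, then the point attaining the [j]-th coordinate agrees with it
   in all coordinates, by the defining inequalities of the polytrope. *)
Lemma column_extremal A n (w : 'I_n -> torus R d) j :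
  A j j = 0 -> (forall k, polytrope_of A (w k)) ->
  minplus_hull w (torus_pi (col j A)) -> exists k, w k = torus_pi (col j A).
Proof.
move=> A0 Qw; under [w in minplus_hull w]funext do rewrite -[w _]torus_pi_repr.
rewrite minplus_hull_pi => -[lam cmin]; have [[k kE] _] := cmin j.
have := Qw k; rewrite -[w k]torus_pi_repr polytrope_of_pi => Qk.
exists k; rewrite -[w k]torus_pi_repr.
apply/torus_piP; exists (- lam k); apply/matrixP => i l; rewrite ord1 !mxE.
have [_ /(_ k)] := cmin i; have := Qk i j; move: kE; rewrite !mxE A0; lra.
Qed.

(** If the columns differ by a constant, rows [j] and [k] give [A j k + A k j = 0]. *)
Lemma column_inj A j k : (forall i, A i i = 0) ->
  (forall i j, i != j -> 0 < A i j + A j i) ->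
  torus_pi (col j A) = torus_pi (col k A) -> j = k.
Proof.
move=> A0 Apos /torus_piP [c cE]; apply/eqP; apply: contraT => /Apos.
have /matrixP/(_ j 0) := cE; have /matrixP/(_ k 0) := cE.
by rewrite !mxE !A0; lra.
Qed.

(** By extremality every column occurs among the points [w k]. Distinct columns have distinct
    indices, so [t] is a permutation, and [w] lists the columns along its inverse. *)
Lemma minplus_verticesP A (w : 'I_d -> torus R d) :
  (forall i, A i i = 0) -> (forall i j k, A i k <= A i j + A j k) ->
  (forall i j, i != j -> 0 < A i j + A j i) ->
  minplus_vertices (polytrope_of A) w <->
  exists s : 'S_d, forall j, w j = torus_pi (col (s j) A).
Proof.
move=> A0 Atri Apos; split=> [Qw|[s /funext ->]]; last first.
  exact: polytrope_of_columns.
have /choice [t tE] j : exists k, w k = torus_pi (col j A).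
  apply: column_extremal => // [k|]; first by rewrite Qw; exact: minplus_hull_vertex.
  by rewrite -Qw polytrope_of_pi => i k; rewrite !mxE; have := Atri i k j; lra.
have t_inj : injective t.
  by move=> j k tjk; apply: (column_inj A0 Apos); rewrite -!tE tjk.
by exists (perm t_inj)^-1%g => j; rewrite -tE -[t _](permE t_inj) permKV.
Qed.

(** Negation carries the polytrope of [A] to that of [A^T], which reduces the claim to the min-plus
    case. *)
Lemma maxplus_verticesP A (w : 'I_d -> torus R d) :
  (forall i, A i i = 0) -> (forall i j k, A i k <= A i j + A j k) ->
  (forall i j, i != j -> 0 < A i j + A j i) ->
  maxplus_vertices (polytrope_of A) w <->
  exists s : 'S_d, forall j, w j = torus_pi (col (s j) (- A^T)).
Proof.
move=> A0 Atri Apos.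
have QT y : polytrope_of A^T (- y) <-> polytrope_of A y.
  rewrite -[y]torus_pi_repr -torus_piN !polytrope_of_pi.
  by split=> Qy i j; have := Qy j i; rewrite !mxE; lra.
have -> : maxplus_vertices (polytrope_of A) w <->
    minplus_vertices (polytrope_of A^T) (fun j => - w j).
  split=> Qw; apply/seteqP; split=> y.
  - by rewrite -{1}[y]opprK QT Qw maxplus_hullN opprK.
  - by rewrite -{1}[y]opprK -maxplus_hullN -Qw -QT opprK.
  - by rewrite -QT Qw maxplus_hullN.
  - by rewrite maxplus_hullN -Qw QT.
rewrite minplus_verticesP => [|i|i j k|i j]; rewrite ?mxE //; last first.
- by move=> /Apos; rewrite addrC.
- by rewrite addrC.
have colN j : torus_pi (col j (- A^T)) = - torus_pi (col j A^T).
  by rewrite -torus_piN; congr torus_pi; apply/matrixP => i k; rewrite !mxE.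
split=> -[s sE]; exists s => j; first by rewrite colN -sE opprK.
by rewrite sE colN opprK.
Qed.

End Hulls.

(** * Dimension of the polytrope *)

Section Dimension.
Variable R : realType.

(** A left kernel vector of [B] is an affine relation: its rows are the points normalised to first
    coordinate zero, with that coordinate replaced by one. It has more rows than columns. *)
Lemma torus_affinely_dependent d (x : 'I_d.+2 -> torus R d.+1) :
  ~ affinely_independent x.
Proof.
move=> x_indep.
pose B : 'M[R]_(d.+2, d.+1) :=
  \matrix_(i, k) (if k == 0 then 1 else repr (x i) k 0 - repr (x i) 0 0).
have : kermx B != 0.
  by rewrite kermx_eq0 /row_free neq_ltn ltnS rank_leq_col.
move=> /rowV0Pn [c /sub_kermxP cB] /negP; apply; apply/eqP/rowP => i.
have csum : \sum_i c 0 i = 0.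
  move/matrixP/(_ 0 0): cB; rewrite !mxE => cB0; rewrite -[RHS]cB0.
  apply: eq_bigr => j _.
  by rewrite mxE eqxx mulr1.
rewrite mxE; apply: x_indep => //.
under eq_bigr do rewrite -[x _]torus_pi_repr.
rewrite torus_pi_sum -torus_pi0; apply/torus_piP.
exists (\sum_j c 0 j * repr (x j) 0 0); apply/colP => k.
rewrite subr0 summxE mxE; under eq_bigr do rewrite mxE.
apply/eqP; rewrite -subr_eq0 -sumrB; apply/eqP.
have [->|k0] := eqVneq k 0; first by rewrite big1 // => j _; rewrite subrr.
move/matrixP/(_ 0 k): cB; rewrite !mxE => cB0; rewrite -[RHS]cB0.
apply: eq_bigr => j _.
by rewrite mxE (negPf k0) mulrBr.
Qed.

Lemma polytrope_dimension d (M : 'M[int]_d.+1) :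
  (forall i, M i i = 0) -> (forall i j k, M i k <= M i j + M j k) ->
  (forall i j, i != j -> 0 < M i j + M j i) ->
  has_dimension (polytrope R M) d.
Proof.
move=> M0 Mtri Mpos; split; last first.
  by move=> [x x_indep _]; exact: torus_affinely_dependent x_indep.
(* The sum [s] of the columns satisfies the inequalities defining [d.+1] times
   the polytrope strictly, hence with slack [1] since it is integral. *)
pose s i := \sum_j M i j.
have s_lt i j : i != j -> s i - s j + 1 <= d.+1%:Z * M i j.
  move=> ij; have -> : d.+1%:Z * M i j = \sum_(k < d.+1) M i j.
    by rewrite sumr_const card_ord -mulr_natl natz.
  (* The gap is the sum over [k] of [M i j + M j k - M i k]; all terms are nonnegative, and the one
     at [k = i] is at least 1. *)
  rewrite -lerBrDl -!sumrB (bigD1 i) //= M0 -[1]addr0 lerD ?sumr_ge0 // => [|k _].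
    by have := Mpos _ _ ij; lia.
  by have := Mtri i j k; lia.
pose q : R := d.+1%:R^-1.
(* Moving one coordinate of the barycentre of the columns by [q] changes coordinate differences by
   at most [q], which the slack allows. *)
pose x k := torus_pi (q *: (map_mx intr (\col_i s i) + delta_mx k 0)) : torus R d.+1.
exists x => [c c0 cx|k]; last first.
  apply/polytrope_of_pi => i j; rewrite !mxE eqxx !andbT.
  rewrite -mulrBr mulrC ler_pdivrMr ?ltr0Sn //.
  have [->|ij] := eqVneq i j; first by rewrite !M0 subrr mul0r.
  have : (s i - s j + 1)%:~R <= (d.+1%:Z * M i j)%:~R :> R by rewrite ler_int s_lt.
  rewrite [(_ * _)%:~R]rmorphM mulrC [(_ + 1)%:~R]rmorphD rmorphB /= rmorph1.
  by case: (i == k); case: (j == k) => /=; rewrite ?mulr1n ?mulr0n; lra.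
move: cx; rewrite torus_pi_sum -torus_pi0 => /torus_piP [e]; rewrite subr0 => eE.
have cE k : c k = e * d.+1%:R.
  have := congr1 (fun a : 'cV_d.+1 => a k 0) eE; rewrite summxE mxE.
  under eq_bigr do rewrite !mxE eqxx andbT mulrDr mulrDr.
  rewrite big_split /= -mulr_suml c0 mul0r add0r (bigD1 k) //= big1 => [|j jk].
    by rewrite eqxx addr0 mulr1 => <-; rewrite mulfVK ?pnatr_eq0.
  by rewrite eq_sym (negPf jk) !mulr0.
(* The coefficients are all equal and sum to zero. *)
move=> k; move: c0; under eq_bigr do rewrite cE.
by rewrite sumr_const card_ord cE => /eqP; rewrite mulrn_eq0 /= => /eqP.
Qed.

End Dimension.

(** * Bundling functions built inside proofs as linear maps *)

Section LinearOf.
Variables (A : pzRingType) (U V : lmodType A) (h : U -> V) (h_lin : linear h).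

HB.instance Definition _ := GRing.isLinear.Build A U V *:%R h h_lin.

Lemma linear_ex : exists h' : {linear U -> V}, h' =1 h.
Proof. by exists h. Qed.

End LinearOf.

(** * Scaled matrix units and projectivity of the diagonal lattices *)

Section Valuations.
Variables (K : fieldType) (v : valuation K) (p : K) (hp : v p = 1%:E).

Lemma uniformizer_neq0 : p != 0.
Proof. by apply/eqP => p0; move: hp; rewrite p0 valuation0. Qed.

Lemma le_valuation_shift (m n : int) x :
  (m%:E <= v (p ^ n * x)%R)%E = ((m - n)%:E <= v x)%E.
Proof.
rewrite valuationM (valuation_exp hp).
by case: (v x) => [k| |]; rewrite ?[RHS]lee_fin ?lerBlDl -?EFinD ?lee_fin ?leey ?leNye.
Qed.

Lemma ge_valuation_shift (m n : int) x :
  (v (p ^ n * x)%R <= m%:E)%E = (v x <= (m - n)%:E)%E.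
Proof.
rewrite valuationM (valuation_exp hp).
by case: (v x) => [k| |]; rewrite ?[RHS]lee_fin ?lerBrDl -?EFinD ?lee_fin ?leey ?leNye.
Qed.

(** Contrapositive of the ultrametric inequality: as valuations are integral or infinite, exceeding
    [n] means being at least [n + 1]. *)
Lemma valuation_sum_le (I : finType) (F : I -> K) (n : int) :
  (v (\sum_i F i)%R <= n%:E)%E -> exists i, (v (F i) <= n%:E)%E.
Proof.
move=> vF; apply: contrapT => /forallNP Fn.
suff : ((n + 1)%:E <= v (\sum_i F i)%R)%E.
  by move=> /le_trans/(_ vF); rewrite lee_fin gerDl.
apply: valuation_ge_sum => i; have /negP := Fn i; rewrite -ltNge.
by case: (v (F i)) => [k| |]; rewrite ?leey ?lte_fin ?lee_fin ?lezD1.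
Qed.

Variables (d : nat) (M : 'M[int]_d) (hM : exponent_matrix M).

Lemma unit_in_order (n : int) (i j : 'I_d) :
  M i j <= n -> p ^ n *: delta_mx i j \in order_pred v hM.
Proof.
move=> Mn; apply/order_predP => k l; rewrite !mxE.
have [/andP[/eqP-> /eqP->]|_] := boolP ((k == i) && (l == j)).
  by rewrite mulr1 (valuation_exp hp) lee_fin.
by rewrite mulr0 valuation0 leey.
Qed.

Definition order_unit (n : int) (i j : 'I_d) (Mn : M i j <= n) : Defs.order v hM :=
  exist (fun X => X \in order_pred v hM) _ (unit_in_order Mn).

Lemma mul_unit_mxE m (a : K) (i j : 'I_d) (B : 'M_(d, m)) k l :
  ((a *: delta_mx i j) *m B) k l = (a * B j l) *+ (k == i).
Proof.
rewrite -scalemxAl mxE [in LHS]mxE (bigD1 j) //= big1 => [|q qj]; rewrite mxE.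
  by rewrite eqxx andbT addr0 mulr_natl mulrnAr.
by rewrite (negPf qj) andbF mul0r.
Qed.

Lemma order_scalarD (a b : valuation_ring v) :
  order_scalar hM (a + b) = order_scalar hM a + order_scalar hM b.
Proof. by apply: val_inj; rewrite /= raddfD. Qed.

Lemma order_scalarM (a b : valuation_ring v) :
  order_scalar hM (a * b) = order_scalar hM a * order_scalar hM b.
Proof. by apply: val_inj; rewrite /= scalar_mxM. Qed.

Section Lattices.
Variables (u : 'cV[int]_d) (hu : polytropal M u).
Local Notation L := (diag_lattice hM hp hu).

Lemma diag_latticeP (y : L) i : ((u i 0)%:E <= v (val y i 0)%R)%E.
Proof. by have /(diag_lattice_predP hp) := valP y. Qed.

Lemma uniformizer_col_in : \col_i p ^ u i 0 \in diag_lattice_pred v p u.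
Proof.
by apply/(diag_lattice_predP hp) => i; rewrite mxE (valuation_exp hp).
Qed.

Definition uniformizer_col : L :=
  exist (fun x => x \in diag_lattice_pred v p u) _ uniformizer_col_in.

(** The vector [x0] generates [L], and [y = X y *: x0] with [X y] additive and compatible with the
    action. Hence sending [y] to [X y *: n0], where [n0] lifts [f x0], lifts [f]. *)
Lemma diag_lattice_projective j :
  (forall i, u i 0 - u j 0 = M i j) -> projective L.
Proof.
move=> uE N N' g f g_surj.
have x0_in : p ^ u j 0 *: delta_mx j 0 \in diag_lattice_pred v p u.
  apply/(diag_lattice_predP hp) => i; rewrite !mxE eqxx andbT.
  by case: eqP => [->|_]; rewrite ?mulr1 ?mulr0 ?valuation0 ?leey ?(valuation_exp hp).
pose x0 : L := exist (fun x => x \in diag_lattice_pred v p u) _ x0_in.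
have X_in (y : L) :
    p ^ (- u j 0) *: (val y *m delta_mx 0 j) \in order_pred v hM.
  apply/order_predP => i k; rewrite !mxE big_ord1 !mxE eqxx /=.
  case: eqP => [->|_]; last by rewrite !mulr0 valuation0 leey.
  by rewrite mulr1 le_valuation_shift -uE opprK subrK diag_latticeP.
pose X y : Defs.order v hM := exist (fun A => A \in order_pred v hM) _ (X_in y).
have Xx0 y : X y *: x0 = y.
  apply: val_inj; rewrite /= -scalemxAl -scalemxAr scalerA -expfzDr ?uniformizer_neq0 //.
  rewrite addNr expr0z scale1r -mulmxA mul_delta_mx.
  by apply/colP => i; rewrite mxE big_ord1 mxE mulr1.
have [n0 gn0] := g_surj (f x0).
have h_lin : linear (fun y => X y *: n0).
  move=> A y z; rewrite scalerA -scalerDl; congr (_ *: _); apply: val_inj => /=.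
  by rewrite mulmxDl scalerDr -mulmxA scalemxAr.
have [h hE] := linear_ex h_lin; exists h => y /=.
by rewrite hE linearZ gn0 -linearZ Xx0.
Qed.

(* A splitting of the surjection [X |-> X x0] from the order onto the lattice,
   where [x0 = (p ^ u i)_i], maps [x0] to a matrix [H] with [H x0 = x0]; linearity
   forces the columns of [H] to be proportional to [x0], and the column of [H]
   responsible for the valuation in [H x0 = x0] is the desired one. *)
Lemma projective_diag_lattice (i : 'I_d) :
  projective L -> exists k, forall j, u j 0 - u k 0 = M j k.
Proof.
move=> Lproj; have [M0 Mtri] := hM; have p0 := uniformizer_neq0.
have g_lin : linear (fun X : (Defs.order v hM)^o => X *: uniformizer_col).
  by move=> A X Y; rewrite scalerDl scalerA.
have [g gE] := linear_ex g_lin.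
have g_surj y : exists X, g X = y.
  (* A diagonal matrix rescales the coordinates of [uniformizer_col] to those of [y]. *)
  have X_in : diag_mx (\row_i (p ^ (- u i 0) * val y i 0)) \in order_pred v hM.
    apply/order_predP => k l; rewrite !mxE; case: eqP => [->|_]; last first.
      by rewrite valuation0 leey.
    by rewrite M0 mulr1n le_valuation_shift opprK add0r diag_latticeP.
  exists (exist (fun A => A \in order_pred v hM) _ X_in).
  rewrite gE; apply: val_inj; apply/colP => k.
  by rewrite /= mul_diag_mx !mxE mulrAC -expfzDr // addNr expr0z mul1r.
have id_lin : linear (fun x : L => x) by [].
have [f fE] := linear_ex id_lin; have [h hE] := Lproj _ _ g f g_surj.
pose x0 := uniformizer_col; pose H : 'M[K]_d := val (h x0).
have Hx0 : H *m val x0 = val x0.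
  by have := hE x0; rewrite /= gE fE => /(congr1 val).
have [k Hik] : exists k, (v (H i k * p ^ u k 0)%R <= (u i 0)%:E)%E.
  apply: valuation_sum_le; move/colP/(_ i): Hx0; rewrite !mxE.
  by under eq_bigr do rewrite mxE; move=> ->; rewrite (valuation_exp hp).
exists k => j; apply/eqP; rewrite eq_le hu /=.
(* The exponent is chosen so that the scaled units at [(i, j)] and [(i, i)] agree on [x0]; applying
   [h] then relates [H j k] to [H i k]. *)
have Mii : M i i <= M i j + u j 0 - u i 0 by rewrite M0 subr_ge0 -lerBlDr.
have : order_unit (lexx (M i j)) *: x0 = order_unit Mii *: x0.
  apply: val_inj; apply/colP => l; rewrite /= !mul_unit_mxE !mxE.
  by rewrite -!expfzDr // subrK.
move=> /(congr1 h); rewrite !linearZ => /(congr1 val)/matrixP/(_ i k).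
rewrite /= !mul_unit_mxE eqxx !mulr1n -/H => Hjk.
have : (v (p ^ M i j * H j k)%R <= (M i j + u j 0 - u k 0)%:E)%E.
  rewrite Hjk ge_valuation_shift; move: Hik; rewrite mulrC ge_valuation_shift.
  by congr (_ <= _%:E)%E; ring.
rewrite ge_valuation_shift; have /order_predP/(_ j k) := valP (h x0).
move=> /le_trans le_H /le_H; rewrite lee_fin.
by have -> : M i j + u j 0 - u k 0 - M i j = u j 0 - u k 0 by ring.
Qed.

End Lattices.
End Valuations.

(** * Recognising lattices, and splitting exact sequences over the valuation ring *)

Section InjectiveLattices.
Variables (K : fieldType) (v : valuation K) (p : K) (hp : v p = 1%:E).
Variables (d : nat) (M : 'M[int]_d) (hM : exponent_matrix M).
Local Notation A := (Defs.order v hM).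

(** The coordinates in [P] identify [L] with a product of fractional ideals generated by [p ^ e i];
    the elements with one coordinate [p ^ e i] and the others zero form a basis. The predicate [P]
    serves to discard redundant coordinates. *)
Lemma lattice_of_coordinates (L : lmodType A) (I : finType) (P : pred I)
    (e : I -> int) (phi : L -> I -> K) :
  (forall a x y i, phi (order_scalar hM a *: x + y) i = val a * phi x i + phi y i) ->
  (forall x y, (forall i, P i -> phi x i = phi y i) -> x = y) ->
  (forall x i, P i -> ((e i)%:E <= v (phi x i))%E) ->
  (forall w : I -> K, (forall i, ((e i)%:E <= v (w i))%E) ->
     exists x, forall i, P i -> phi x i = w i) ->
  is_lattice L.
Proof.
move=> phi_lin phi_inj phi_ge phi_surj; have p0 := uniformizer_neq0 hp.
have basis (k : 'I_#|P|) :
    exists b, forall i, P i -> phi b i = if i == enum_val k then p ^ e i else 0.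
  apply: phi_surj => i; case: eqP => _; last by rewrite valuation0 leey.
  by rewrite (valuation_exp hp).
have {basis} [b bE] := choice basis.
have phi0 i : phi 0 i = 0.
  by have := phi_lin 1 0 0 i; rewrite scaler0 addr0 mul1r -{1}[phi 0 i]addr0 => /addrI.
have sumE (c : 'I_#|P| -> valuation_ring v) i :
    P i -> phi (\sum_k order_scalar hM (c k) *: b k) i =
           \sum_k val (c k) * (if i == enum_val k then p ^ e i else 0).
  move=> Pi; elim/big_rec2: _ => [|k x y _ IH]; first exact: phi0.
  by rewrite phi_lin IH bE.
have sumE1 (c : 'I_#|P| -> valuation_ring v) k :
    phi (\sum_k order_scalar hM (c k) *: b k) (enum_val k) =
    p ^ e (enum_val k) * val (c k).
  rewrite sumE; last exact: (enum_valP k).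
  rewrite (bigD1 k) //= eqxx big1 ?addr0 1?mulrC // => l lk.
  by rewrite (inj_eq enum_val_inj) eq_sym (negPf lk) mulr0.
have c_in x (k : 'I_#|P|) :
    p ^ (- e (enum_val k)) * phi x (enum_val k) \in valuation_integer v.
  rewrite unfold_in -[0%E]/((0 : int)%:E) le_valuation_shift // opprK add0r.
  by apply: phi_ge; exact: (enum_valP k).
exists #|P|, b.
exists (fun x => [ffun k => exist (fun z => z \in valuation_integer v) _ (c_in x k)]).
  move=> c; apply/ffunP => k; rewrite ffunE; apply: val_inj => /=.
  by rewrite sumE1 mulrA -expfzDr // addNr expr0z mul1r.
move=> x; apply: phi_inj => i Pi; rewrite -(enum_rankK_in Pi Pi) sumE1 ffunE /=.
by rewrite mulrA -expfzDr // subrr expr0z mul1r.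
Qed.

(* A lattice is free over the valuation ring, so that short exact sequences
   ending in a lattice split over the valuation ring. *)
Lemma lattice_retraction (X Y Z : lmodType A) (f : {linear X -> Y})
    (g : {linear Y -> Z}) :
  short_exact f g -> is_lattice Z ->
  exists2 r : Y -> X, cancel f r &
    forall a y z, r (order_scalar hM a *: y + z) = order_scalar hM a *: r y + r z.
Proof.
move=> [f_inj exact_fg g_surj] [n [b [c cK Kc]]].
have {g_surj} [y_ yE] := choice (fun k => g_surj (b k)).
(* [s] is a section of [g] lifting a basis of [Z]; the retraction takes [y] to the preimage under
   [f] of [y - s (g y)]. *)
pose s z : Y := \sum_k order_scalar hM (c z k) *: y_ k.
have gs z : g (s z) = z.
  by rewrite -[RHS]Kc linear_sum; apply: eq_bigr => k _; rewrite linearZ yE.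
have c_lin a z z' : c (order_scalar hM a *: z + z') = [ffun k => a * c z k + c z' k].
  apply: (can_inj cK); rewrite Kc -{1}[z]Kc -{1}[z']Kc scaler_sumr -big_split /=.
  by apply: eq_bigr => k _; rewrite ffunE order_scalarD order_scalarM scalerDl scalerA.
have s_lin a z z' : s (order_scalar hM a *: z + z') = order_scalar hM a *: s z + s z'.
  rewrite /s scaler_sumr -big_split /=; apply: eq_bigr => k _.
  by rewrite c_lin ffunE order_scalarD order_scalarM scalerDl scalerA.
have /choice [r rE] y : exists x, f x = y - s (g y).
  by apply/exact_fg; rewrite linearB gs subrr.
exists r => [x|a y z]; apply: f_inj.
  rewrite rE (_ : g (f x) = 0); last by apply/exact_fg; exists x.
  (* Linearity with scalar 1 yields [s 0 = 0]. *)
  have := s_lin 1 0 0; 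
  have -> : order_scalar hM (1 : valuation_ring v) = 1 :> A by exact: val_inj.
  by rewrite !scale1r addr0 -{1}[s 0]addr0 => /addrI <-; rewrite subr0.
by rewrite linearP !rE linearP s_lin scalerBr opprD addrACA.
Qed.

End InjectiveLattices.

(** * Modules of matrices stable under left multiplication by the order *)

Section StableMatrices.
Variables (K : fieldType) (v : valuation K) (d m : nat).
Variables (M : 'M[int]_d) (hM : exponent_matrix M) (S : {pred 'M[K]_(d, m)}).
Hypothesis S_zmod : zmod_closed S.
Hypothesis S_stable :
  forall (X : Defs.order v hM) B, B \in S -> val X *m B \in S.

(* The hypotheses are arguments of the type, because the module structure
   depends on them. *)
Definition stable_mx (_ : zmod_closed S)
    (_ : forall (X : Defs.order v hM) B, B \in S -> val X *m B \in S) :=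
  {B : 'M[K]_(d, m) | B \in S}.

Local Notation T := (stable_mx S_zmod S_stable).

HB.instance Definition _ := SubChoice.on T.
HB.instance Definition _ := GRing.SubChoice_isSubZmodule.Build
  'M[K]_(d, m) S T S_zmod.

Definition stable_mx_scale (X : Defs.order v hM) (B : T) : T :=
  exist (fun B => B \in S) (val X *m val B) (S_stable X (valP B)).

Lemma stable_mx_scaleA X Y B :
  stable_mx_scale X (stable_mx_scale Y B) = stable_mx_scale (X * Y) B.
Proof. by apply: val_inj; rewrite /= mulmxA. Qed.

Lemma stable_mx_scale1 : left_id 1 stable_mx_scale.
Proof. by move=> B; apply: val_inj; rewrite /= mul1mx. Qed.

Lemma stable_mx_scaleDr : right_distributive stable_mx_scale +%R.
Proof. by move=> X B C; apply: val_inj; rewrite /= mulmxDr. Qed.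

Lemma stable_mx_scaleDl B : {morph stable_mx_scale^~ B : X Y / X + Y}.
Proof. by move=> X Y; apply: val_inj; rewrite /= mulmxDl. Qed.

HB.instance Definition _ := GRing.Zmodule_isLmodule.Build (Defs.order v hM) T
  stable_mx_scaleA stable_mx_scale1 stable_mx_scaleDr stable_mx_scaleDl.

End StableMatrices.

(** * Injectivity of the diagonal lattices *)

Section InjectiveDiagLattices.
Variables (K : fieldType) (v : valuation K) (p : K) (hp : v p = 1%:E).
Variables (d : nat) (M : 'M[int]_d) (hM : exponent_matrix M).
Variables (u : 'cV[int]_d) (hu : polytropal M u).
Local Notation A := (Defs.order v hM).
Local Notation L := (diag_lattice hM hp hu).

(* The lattice is dual to a projective one: a homomorphism [h] into it is
   determined by its [j]-th coordinate, a linear form over the valuation ring,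
   through [h(y)_i = p ^- M j i * h(p ^ M j i E_ji y)_j], and linear forms extend
   along split injections. *)
Lemma diag_lattice_injective j :
  (forall i, u j 0 - u i 0 = M j i) -> injective_lattice L.
Proof.
move=> uE X Y Z f g _ _ latZ ex_fg h; have [M0 Mtri] := hM.
have p0 := uniformizer_neq0 hp.
have [r rK r_lin] := lattice_retraction ex_fg latZ.
pose E i := order_unit hp hM (lexx (M j i)).
pose psi y := val (h (r y)) j 0.
have psi_lin a y z : psi (order_scalar hM a *: y + z) = val a * psi y + psi z.
  by rewrite /psi r_lin linearP /= mxE mul_scalar_mx mxE.
have psi0 : psi 0 = 0.
  by have := psi_lin 1 0 0; rewrite scaler0 addr0 mul1r -{1}[psi 0]addr0 => /addrI.
have k_in y : \col_i (p ^ (- M j i) * psi (E i *: y)) \in diag_lattice_pred v p u.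
  apply/(diag_lattice_predP hp) => i; rewrite mxE le_valuation_shift //.
  by rewrite opprK -uE addrC subrK; exact: diag_latticeP.
pose k y : L := exist (fun x => x \in diag_lattice_pred v p u) _ (k_in y).
have k_lin : linear k.
  move=> B y z; apply: val_inj; apply/colP => i; rewrite /= !mxE.
  (* These are the coefficients of [E i * B], supported in row [j], on the units [E l]; the triangle
     inequality makes them integral. *)
  have a_in l : p ^ (M j i - M j l) * val B i l \in valuation_integer v.
    rewrite unfold_in -[0%E]/((0 : int)%:E) le_valuation_shift //.
    have /order_predP/(_ i l) := valP B; apply: le_trans.
    by rewrite lee_fin sub0r opprB lerBlDl; exact: Mtri.
  pose a l : valuation_ring v := exist (fun z => z \in valuation_integer v) _ (a_in l).
  have EB : E i * B = \sum_l order_scalar hM (a l) * E l.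
    apply: val_inj; rewrite raddf_sum /=; apply/matrixP => q l.
    rewrite -[LHS]/((_ *m val B) q l) mul_unit_mxE summxE (bigD1 l) //=.
    rewrite big1 ?addr0 => [|t tl]; last first.
      rewrite -[LHS]/((_ *m _) _ _) mul_scalar_mx !mxE.
      by rewrite [l == t]eq_sym (negPf tl) andbF !mulr0.
    rewrite -[RHS]/((_ *m _) _ _) mul_scalar_mx !mxE eqxx andbT.
    by rewrite mulrA [_ * p ^ _]mulrAC -expfzDr // subrK mulr_natr.
  have psiE : psi (E i *: (B *: y + z)) =
      \sum_l val (a l) * psi (E l *: y) + psi (E i *: z).
    rewrite scalerDr scalerA EB scaler_suml.
    elim/big_rec2: _ => [|l s t _ IH]; first by rewrite !add0r.
    by rewrite -addrA -scalerA psi_lin IH addrA.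
  rewrite psiE mulrDr mulr_sumr; congr (_ + _); apply: eq_bigr => l _.
  rewrite mxE /= !mulrA -expfzDr // addrA addNr add0r.
  by rewrite [_ * val B i l]mulrC.
have [k' k'E] := linear_ex k_lin; exists k' => x /=; rewrite k'E.
apply: val_inj; apply/colP => i; rewrite /= mxE /psi -linearZ rK linearZ /=.
by rewrite mul_unit_mxE eqxx mulrA -expfzDr // addNr expr0z mul1r.
Qed.

(* The direct sum over [j] of the lattices of the columns of [- M^T], each translated
   by [u j] so that [L] embeds as the matrices with constant rows. *)
Definition envelope_pred : {pred 'M[K]_d} := fun B =>
  `[< forall i j, ((u j 0 - M j i)%:E <= v (B i j))%E >].

Lemma envelope_predP (B : 'M[K]_d) :
  reflect (forall i j, ((u j 0 - M j i)%:E <= v (B i j))%E) (B \in envelope_pred).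
Proof. exact: asboolP. Qed.

Lemma envelope_zmod : zmod_closed envelope_pred.
Proof.
split; first by apply/envelope_predP => i j; rewrite mxE valuation0 leey.
move=> B C /envelope_predP vB /envelope_predP vC; apply/envelope_predP => i j.
by rewrite !mxE; apply: valuation_geD => //; rewrite valuationN.
Qed.

Lemma envelope_stable (X : A) B : B \in envelope_pred -> val X *m B \in envelope_pred.
Proof.
have [_ Mtri] := hM; have /order_predP vX := valP X.
move=> /envelope_predP vB; apply/envelope_predP => i j; rewrite mxE.
apply: valuation_ge_sum => l; apply: le_trans (valuation_geM (vX i l) (vB l j)).
by rewrite -EFinD lee_fin; have := Mtri j i l; lia.
Qed.

Variable j0 : 'I_d.

(* The image of the envelope under [B |-> (B i j - B i j0)_ij], whose kernel consists
   of the matrices with constant rows. *)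
Definition coker_pred : {pred 'M[K]_d} := fun C =>
  `[< (forall i, C i j0 = 0) /\
      (forall i j, ((u j 0 - M j i)%:E <= v (C i j - C i i)%R)%E) >].

Lemma coker_predP (C : 'M[K]_d) :
  reflect ((forall i, C i j0 = 0) /\
           (forall i j, ((u j 0 - M j i)%:E <= v (C i j - C i i)%R)%E))
    (C \in coker_pred).
Proof. exact: asboolP. Qed.

Lemma coker_zmod : zmod_closed coker_pred.
Proof.
split.
  by apply/coker_predP; split=> i *; rewrite !mxE ?subrr ?valuation0 ?leey.
move=> B C /coker_predP [B0 vB] /coker_predP [C0 vC]; apply/coker_predP.
split=> [i|i j]; rewrite !mxE; first by rewrite B0 C0 subrr.
rewrite [X in v X](_ : _ = (B i j - B i i) - (C i j - C i i)); last by ring.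
by apply: valuation_geD => //; rewrite valuationN.
Qed.

Lemma coker_stable (X : A) C : C \in coker_pred -> val X *m C \in coker_pred.
Proof.
have [_ Mtri] := hM; have /order_predP vX := valP X.
move=> /coker_predP [C0 vC]; apply/coker_predP; split=> [i|i j].
  by rewrite mxE big1 // => l _; rewrite C0 mulr0.
rewrite !mxE -sumrB; apply: valuation_ge_sum => l; rewrite -mulrBr.
(* Membership bounds differences with the diagonal entry of row [l], so that entry is inserted. *)
rewrite [C l j - _](_ : _ = (C l j - C l l) - (C l i - C l l)); last by ring.
rewrite mulrBr; apply: valuation_geD; rewrite ?valuationN.
  apply: le_trans (valuation_geM (vX i l) (vC l j)).
  by rewrite -EFinD lee_fin; have := Mtri j i l; lia.
apply: le_trans (valuation_geM (vX i l) (vC l i)).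
by rewrite -EFinD lee_fin; have : u j 0 - u i 0 <= M j i := hu j i; lia.
Qed.

Notation envelope := (stable_mx envelope_zmod envelope_stable).
Notation coker := (stable_mx coker_zmod coker_stable).

Lemma envelope_lattice : is_lattice (envelope : lmodType A).
Proof.
pose e (x : 'I_d * 'I_d) := u x.2 0 - M x.2 x.1.
pose phi (B : envelope) x := val B x.1 x.2.
apply: (@lattice_of_coordinates _ _ _ hp _ _ _ _ _ predT e phi).
- by move=> a B C x; rewrite /phi /= mul_scalar_mx !mxE.
- move=> B C BC; apply: val_inj; apply/matrixP => i j; exact: (BC (i, j)).
- by move=> B [i j] _; have /envelope_predP := valP B; apply.
- move=> w vw; have B_in : \matrix_(i, j) w (i, j) \in envelope_pred.
    by apply/envelope_predP => i j; rewrite mxE; exact: (vw (i, j)).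
  exists (exist (fun B => B \in envelope_pred) _ B_in) => -[i j] _.
  by rewrite /phi /= mxE.
Qed.

(** The off-diagonal differences [C i j - C i i] are free coordinates; the diagonal is recovered
    from them because column [j0] vanishes. *)
Lemma coker_lattice : is_lattice (coker : lmodType A).
Proof.
have [M0 _] := hM.
pose e (x : 'I_d * 'I_d) := u x.2 0 - M x.2 x.1.
pose phi (C : coker) x := val C x.1 x.2 - val C x.1 x.1.
apply: (@lattice_of_coordinates _ _ _ hp _ _ _ _ _ (fun x => x.1 != x.2) e phi).
- by move=> a B C x; rewrite /phi /= mul_scalar_mx !mxE; ring.
- move=> B C BC; apply: val_inj; apply/matrixP => i j.
  have BC' l : val B i l - val B i i = val C i l - val C i i.
    have [->|il] := eqVneq i l; first by rewrite !subrr.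
    exact: (BC (i, l) il).
  have /coker_predP [B0 _] := valP B; have /coker_predP [C0 _] := valP C.
  have := BC' j0; rewrite B0 C0 !sub0r => /oppr_inj BCi.
  by have := BC' j; rewrite BCi => /addIr.
- by move=> C [i j] _; have /coker_predP [_] := valP C; apply.
(* [D] has the prescribed differences and zero diagonal; subtracting its column [j0] normalises it
   without changing them. *)
- move=> w vw; pose D i j := if i == j then 0 else w (i, j).
  have DE i j : D i j - D i j0 - (D i i - D i j0) = D i j.
    by rewrite /D eqxx sub0r opprK subrK.
  have C_in : \matrix_(i, j) (D i j - D i j0) \in coker_pred.
    apply/coker_predP; split=> i *; rewrite !mxE ?subrr // DE /D.
    by case: eqP => _; rewrite ?valuation0 ?leey //; exact: (vw (i, _)).
  exists (exist (fun C => C \in coker_pred) _ C_in) => -[i j] ij.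
  by rewrite /phi /= !mxE DE /D (negPf ij).
Qed.

(** A matrix with constant rows comes from [L] since its diagonal entries satisfy the bounds [u i].
    A matrix [C] in the cokernel lifts to that of the [C i j - C i i], which differs from [C] by a
    matrix with constant rows. *)
Lemma envelope_exact : exists (f : {linear L -> (envelope : lmodType A)})
    (g : {linear (envelope : lmodType A) -> (coker : lmodType A)}),
  short_exact f g /\ forall y i j, val (f y) i j = val y i 0.
Proof.
have [M0 Mtri] := hM.
have f_in (y : L) : val y *m const_mx 1 \in envelope_pred.
  apply/envelope_predP => i j; rewrite mxE big_ord1 mxE mulr1.
  apply: le_trans (diag_latticeP y i); rewrite lee_fin.
  by have : u j 0 - u i 0 <= M j i := hu j i; lia.
pose f0 (y : L) : envelope := exist (fun B => B \in envelope_pred) _ (f_in y).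
have fE0 y i j : val (f0 y) i j = val y i 0 by rewrite /= mxE big_ord1 mxE mulr1.
have f0_lin : linear f0.
  by move=> X y z; apply: val_inj; rewrite /= mulmxDl mulmxA.
have gE1 (B : 'M[K]_d) i j :
    (B - col j0 B *m (const_mx 1 : 'rV_d)) i j = B i j - B i j0.
  by rewrite !mxE big_ord1 !mxE mulr1.
have g_in (B : envelope) : val B - col j0 (val B) *m const_mx 1 \in coker_pred.
  have /envelope_predP vB := valP B.
  apply/coker_predP; split=> [i|i j]; first by rewrite gE1 subrr.
  rewrite !gE1 opprB addrA subrK; apply: valuation_geD => //.
  rewrite valuationN; apply: le_trans (vB i i); rewrite lee_fin M0 subr0.
  by have : u j 0 - u i 0 <= M j i := hu j i; lia.
pose g0 (B : envelope) : coker := exist (fun B => B \in coker_pred) _ (g_in B).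
have g0_lin : linear g0.
  move=> X B C; apply: val_inj.
  by rewrite /= !colE !mulmxDl mulmxBr opprD addrACA !mulmxA.
have [f fE] := linear_ex f0_lin; have [g gE] := linear_ex g0_lin.
exists f, g; split=> [|y i j]; last by rewrite fE.
split.
- move=> y z /(congr1 val)/matrixP yz; apply: val_inj; apply/colP => i.
  by have := yz i j0; rewrite !fE !fE0.
- move=> B; rewrite gE; split=> [/(congr1 val)/matrixP gB0|[y <-]]; last first.
    by apply: val_inj; apply/matrixP => i j; rewrite fE gE1 !fE0 subrr mxE.
  have BE i j : val B i j = val B i j0.
    by apply/eqP; rewrite -subr_eq0 -gE1; apply/eqP; rewrite [LHS]gB0 mxE.
  have y_in : col j0 (val B) \in diag_lattice_pred v p u.
    apply/(diag_lattice_predP hp) => i; rewrite mxE -(BE i i).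
    by have /envelope_predP/(_ i i) := valP B; rewrite M0 subr0.
  exists (exist (fun y => y \in diag_lattice_pred v p u) _ y_in).
  by rewrite fE; apply: val_inj; apply/matrixP => i j; rewrite fE0 /= mxE BE.
- move=> C; have /coker_predP [C0 vC] := valP C.
  have B_in : \matrix_(i, j) (val C i j - val C i i) \in envelope_pred.
    by apply/envelope_predP => i j; rewrite mxE.
  exists (exist (fun B => B \in envelope_pred) _ B_in); rewrite gE.
  apply: val_inj; apply/matrixP => i j.
  by rewrite gE1 /= !mxE C0 sub0r opprK subrK.
Qed.

(** Extending the identity of [L] along the embedding gives a retraction [k]. Some [k (t j)] has
    small valuation in coordinate [i]; linearity carries this to [v (k (t j))_l <= u j - M j l] for
    all [l], while membership in [L] gives the lower bound [u l]. *)
Lemma injective_diag_lattice :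
  injective_lattice L -> exists k, forall j, u k 0 - u j 0 = M k j.
Proof.
move=> Linj; have [M0 Mtri] := hM; have p0 := uniformizer_neq0 hp.
have [f [g [ex_fg fE]]] := envelope_exact.
have id_lin : linear (fun x : L => x) by [].
have [h hE] := linear_ex id_lin.
have [k kE] := Linj _ _ _ f g (diag_lattice_is_lattice hM hp hu)
  envelope_lattice coker_lattice ex_fg h.
(* [t j] lies in the [j]-th summand, with the least valuations allowed there. *)
have t_in j : \matrix_(i, l) (p ^ (u j 0 - M j i) *+ (l == j)) \in envelope_pred.
  apply/envelope_predP => i l; rewrite mxE.
  case: eqP => [->|_]; last by rewrite valuation0 leey.
  by rewrite mulr1n (valuation_exp hp).
pose t j : envelope := exist (fun B => B \in envelope_pred) _ (t_in j).
pose i := j0; pose x0 : L := uniformizer_col hp hM hu.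
have a_ge j : M i i <= u i 0 - u j 0 + M j i.
  by rewrite M0 addrC -opprB subr_ge0; exact: hu.
(* Row [i] of [f x0] is assembled from the summands, [t j] supplying the entry in column [j]. *)
have fx0 : order_unit hp hM (lexx (M i i)) *: f x0 =
           \sum_j order_unit hp hM (a_ge j) *: t j.
  apply: val_inj; apply/matrixP => q l; rewrite raddf_sum /= summxE.
  rewrite -[LHS]/((_ *m _) q l) mul_unit_mxE fE mxE (bigD1 l) //= big1 => [|j jl].
    rewrite -[X in _ = X + _]/((_ *m _) q l) mul_unit_mxE mxE eqxx mulr1n addr0.
    by rewrite -!expfzDr // M0; congr (_ ^ _ *+ _); ring.
  by rewrite -[LHS]/((_ *m _) q l) mul_unit_mxE mxE eq_sym (negPf jl) mulr0 mul0rn.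
have [j vj] : exists j, (v (p ^ (u i 0 - u j 0 + M j i) * val (k (t j)) i 0)%R
    <= (u i 0)%:E)%E.
  apply: valuation_sum_le; rewrite -(valuation_exp hp) le_eqVlt; apply/orP; left.
  apply/eqP; congr (v _).
  have /(congr1 k) := fx0; rewrite linearZ.
  rewrite [k (f x0)](kE x0) hE linear_sum => /(congr1 val)/colP/(_ i).
  rewrite raddf_sum summxE /= mul_unit_mxE !mxE eqxx M0 expr0z mul1r mulr1n => ->.
  by apply: eq_bigr => j _; rewrite linearZ /= mul_unit_mxE eqxx.
exists j => l; apply/eqP; rewrite eq_le hu /=.
have b_ge : M l l <= M l i + M j l - M j i.
  by rewrite M0 subr_ge0 addrC; exact: Mtri.
(* Two scaled units agree on [t j]; applying [k] relates coordinates [i] and [l] of [k (t j)]. *)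
have : order_unit hp hM (lexx (M l i)) *: t j = order_unit hp hM b_ge *: t j.
  apply: val_inj; apply/matrixP => q s.
  rewrite -[LHS]/((_ *m _) q s) -[RHS]/((_ *m _) q s) !mul_unit_mxE !mxE.
  case: (s == j); rewrite ?mulr0n ?mulr0 // !mulr1n -!expfzDr //.
  by congr (_ ^ _ *+ _); ring.
move=> /(congr1 k); rewrite !linearZ => /(congr1 val)/colP/(_ l).
rewrite /= !mul_unit_mxE eqxx !mulr1n => kt.
have : (v (p ^ M l i * val (k (t j)) i 0)%R <= (M l i + u j 0 - M j i)%:E)%E.
  move: vj; rewrite !ge_valuation_shift //.
  by congr (_ <= _%:E)%E; ring.
rewrite kt ge_valuation_shift // => /(le_trans (diag_latticeP (k (t j)) l)).
rewrite lee_fin.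
have -> : M l i + u j 0 - M j i - (M l i + M j l - M j i) = u j 0 - M j l by ring.
by rewrite lerBrDl -lerBrDr.
Qed.

End InjectiveDiagLattices.

(** * Equality of integer points in the torus, and the assembly of the theorem *)

Lemma int_point_eqP (R : realType) d (u w : 'cV[int]_d) (j : 'I_d) :
  int_point R u = int_point R w <-> forall i, u i 0 - w i 0 = u j 0 - w j 0.
Proof.
rewrite /int_point; split=> [/torus_piP [c cE] i|uw].
  apply: (@intr_inj R); rewrite !rmorphB /=.
  have := congr1 (fun x : 'cV_d => x i 0) cE.
  by have := congr1 (fun x : 'cV_d => x j 0) cE; rewrite !mxE => -> ->.
apply/torus_piP; exists (u j 0 - w j 0)%:~R.
by apply/matrixP => i k; rewrite ord1 !mxE -rmorphB uw.
Qed.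

Theorem theorem4p2 (R : realType) (K : fieldType) (v : valuation K)
    (p : K) (hp : v p = 1%:E)
    (d : nat) (hd : (0 < d)%N) (M : 'M[int]_d) (hM : exponent_matrix M)
    (hM0 : forall i j : 'I_d, 0 <= M i j)
    (hMpos : forall i j : 'I_d, i != j -> 0 < M i j + M j i) :
  let Q := polytrope R M in
  let mincol (j : 'I_d) := int_point R (col j M) in
  let maxcol (j : 'I_d) := int_point R (col j (- M^T)) in
  [/\ has_dimension Q d.-1,
      minplus_simplex Q /\ maxplus_simplex Q,
      (forall w : 'I_d -> torus R d, minplus_vertices Q w <->
         exists s : 'S_d, forall j, w j = mincol (s j)) /\
      (forall w : 'I_d -> torus R d, maxplus_vertices Q w <->
         exists s : 'S_d, forall j, w j = maxcol (s j)),
      (forall (u : 'cV[int]_d) (hu : polytropal M u),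
         projective (diag_lattice hM hp hu) <->
         exists j : 'I_d, int_point R u = mincol j)
    & (forall (u : 'cV[int]_d) (hu : polytropal M u),
         injective_lattice (diag_lattice hM hp hu) <->
         exists j : 'I_d, int_point R u = maxcol j)].
Proof.
move=> Q mincol maxcol; have [M0 Mtri] := hM.
pose MR : 'M[R]_d := map_mx intr M.
have MR0 i : MR i i = 0 by rewrite mxE M0.
have MRtri i j k : MR i k <= MR i j + MR j k.
  by rewrite !mxE -rmorphD ler_int.
have MRpos i j : i != j -> 0 < MR i j + MR j i.
  by move=> ij; rewrite !mxE -rmorphD ltr0z; exact: hMpos.
have mincolE j : mincol j = torus_pi (col j MR).
  by rewrite /mincol /int_point map_col.
have maxcolE j : maxcol j = torus_pi (col j (- MR^T)).
  by rewrite /maxcol /int_point map_col map_mxN map_trmx.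
have minP w : minplus_vertices Q w <->
    exists s : 'S_d, forall j, w j = mincol (s j).
  rewrite minplus_verticesP //.
  by split=> -[s sE]; exists s => j; rewrite sE mincolE.
have maxP w : maxplus_vertices Q w <->
    exists s : 'S_d, forall j, w j = maxcol (s j).
  rewrite maxplus_verticesP //.
  by split=> -[s sE]; exists s => j; rewrite sE maxcolE.
split.
- by case: d hd M hM M0 Mtri hMpos @Q {hM0 mincol maxcol MR MR0 MRtri MRpos
    mincolE maxcolE minP maxP} => // d _ M _ M0 Mtri hMpos; exact: polytrope_dimension.
- split; first by exists mincol; apply/minP; exists 1%g => j; rewrite perm1.
  by exists maxcol; apply/maxP; exists 1%g => j; rewrite perm1.
- by split.
- move=> u hu; split=> [/(projective_diag_lattice (Ordinal hd)) [k uE]|[j]].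
    exists k; rewrite /mincol (int_point_eqP _ _ _ k) => i.
    by rewrite !mxE -!uE !opprB subrr addr0 addrC subrK.
  rewrite /mincol (int_point_eqP _ _ _ j) => uE.
  apply: (@diag_lattice_projective _ _ _ hp _ _ hM _ hu j) => i.
  by have := uE i; rewrite !mxE M0; lia.
- move=> u hu; split=> [/(injective_diag_lattice (Ordinal hd)) [k uE]|[j]].
    exists k; rewrite /maxcol (int_point_eqP _ _ _ k) => i.
    by rewrite !mxE -!uE; ring.
  rewrite /maxcol (int_point_eqP _ _ _ j) => uE.
  apply: (@diag_lattice_injective _ _ _ hp _ _ hM _ hu j) => i.
  by have := uE i; rewrite !mxE M0; lia.
Qed.
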